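(* Let $m,n,s,k$ be four integers such that $3\leq s\leq n$, $3\leq k\leq m$ and $ms=nk$. If $s\equiv 0\pmod 4$, then there exists a signed magic array $\mathrm{SMA}(m,n;s,k)$.
   Context: A partially filled (pf) array is a matrix some of whose cells may be empty; row and column sums are taken over the filled cells. A signed magic array $\mathrm{SMA}(m,n;s,k)$ is an $m\times n$ pf array with entries in $\Omega\subset\mathbb{Z}$, where $\Omega=\{0,\pm1,\pm2,\ldots,\pm(nk-1)/2\}$ if $nk$ is odd and $\Omega=\{\pm1,\pm2,\ldots,\pm nk/2\}$ if $nk$ is even, such that: (a) each row contains exactly $s$ filled cells and each column contains exactly $k$ filled cells; (b) every $x\in\Omega$ appears exactly once in the array; (c) the elements in every row and in every column sum to $0$. *)

(* Defs.v *)
From mathcomp Require Import all_boot all_order all_algebra.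

Set Implicit Arguments.
Unset Strict Implicit.
Unset Printing Implicit Defensive.

Import Order.TTheory GRing.Theory Num.Theory.

Local Open Scope ring_scope.

(* Partially filled arrays; [None] is an empty cell. *)
Notation pf_array m n := 'M[option int]_(m, n).

(* The set Omega attached to an array with N filled cells:
   {0, +-1, ..., +-(N-1)/2} for N odd and {+-1, ..., +-N/2} for N even. *)
Definition Omega (N : nat) : pred int :=
  fun x => if odd N then (`|x| <= (N.-1)./2)%N
           else (x != 0) && (`|x| <= N./2)%N.

Record signed_magic_array (m n s k : nat) (A : pf_array m n) : Prop := SMA {
  sma_entries : forall i j x, A i j = Some x -> Omega (n * k) x;
  sma_row_filled : forall i : 'I_m, #|[set j : 'I_n | isSome (A i j)]| = s;
  sma_col_filled : forall j : 'I_n, #|[set i : 'I_m | isSome (A i j)]| = k;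
  sma_once : forall x : int, Omega (n * k) x ->
    #|[set p : 'I_m * 'I_n | A p.1 p.2 == Some x]| = 1%N;
  sma_row_sum : forall i : 'I_m,
    \sum_(j < n | isSome (A i j)) odflt 0 (A i j) = 0;
  sma_col_sum : forall j : 'I_n,
    \sum_(i < m | isSome (A i j)) odflt 0 (A i j) = 0
}.

(* Main.v *)
(* Write the nk entries as one sequence a_0, a_1, ... and put a_p in row p / s and
   column p mod n; as s <= n, no cell is used twice. It then suffices that every
   block of four consecutive entries sums to 0 (hence every row, 4 dividing s) and
   that each residue class of positions mod n sums to 0.

   Pieces of the form X ++ (-X) with n dividing the length of X satisfy the second
   condition, and an alternating choice of signs in X gives the first. These suffice
   for k even. For k odd, n = 4h and three full rows are needed in addition: three
   rows over +-1, ..., +-6h with zero column sums. Columns T, -T, T', -T' have zero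
   row sums, so for h even it is enough to partition [1, 6h] into triples a + b = c.
   For h odd no such partition exists by parity; there six values of the form
   a, b, x, x + a, x + b, x + a + b are set aside, whose signed copies fill a 3 x 4
   array with zero row and column sums that is not symmetric under negation. *)
Require Import Defs.
From mathcomp Require Import all_boot all_order all_algebra.
From mathcomp Require Import zify ring.

Set Implicit Arguments.
Unset Strict Implicit.
Unset Printing Implicit Defensive.

Import GRing.Theory.

Local Open Scope nat_scope.

(** * Arrays obtained by placing values injectively into cells *)

Section ArrayOfPlacement.

Variables (T : finType) (m n : nat) (row : T -> 'I_m) (col : T -> 'I_n).
Variable v : T -> int.
Hypothesis placement_inj : injective (fun t => (row t, col t)).

Definition array_of : pf_array m n :=
  \matrix_(i, j) omap v [pick t | (row t == i) && (col t == j)].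

Lemma array_of_cell t : array_of (row t) (col t) = Some (v t).
Proof.
rewrite mxE; case: pickP => [u /andP[/eqP ru /eqP cu]|/(_ t)]; last by rewrite !eqxx.
by rewrite /= (placement_inj (x1 := u) (x2 := t)) //= ru cu.
Qed.

Lemma array_of_filled i j :
  isSome (array_of i j) -> exists2 t, row t = i & col t = j.
Proof.
by rewrite mxE; case: pickP => // t /andP[/eqP rt /eqP ct] _; exists t.
Qed.

(** Seeing the filled cells of a row as the image of a fibre of [row], on which [col] is injective,
    turns counts and sums over the row into counts and sums over [T]. *)
Lemma row_filledE i :
  [set j | isSome (array_of i j)] = [set col t | t in [set t | row t == i]].
Proof.
apply/setP => j; rewrite inE; apply/idP/imsetP => [/array_of_filled[t rt ct]|].
  by exists t; rewrite ?inE ?rt.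
by case=> t; rewrite inE => /eqP <- ->; rewrite array_of_cell.
Qed.

Lemma col_filledE j :
  [set i | isSome (array_of i j)] = [set row t | t in [set t | col t == j]].
Proof.
apply/setP => i; rewrite inE; apply/idP/imsetP => [/array_of_filled[t rt ct]|].
  by exists t; rewrite ?inE ?ct.
by case=> t; rewrite inE => /eqP <- ->; rewrite array_of_cell.
Qed.

Lemma col_inj_row i : {in [set t | row t == i] &, injective col}.
Proof.
move=> t u; rewrite !inE => /eqP rt /eqP ru ctu.
by apply: placement_inj; rewrite /= rt ru ctu.
Qed.

Lemma row_inj_col j : {in [set t | col t == j] &, injective row}.
Proof.
move=> t u; rewrite !inE => /eqP ct /eqP cu rtu.
by apply: placement_inj; rewrite /= ct cu rtu.
Qed.

Lemma array_of_row_card i :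
  #|[set j | isSome (array_of i j)]| = #|[set t | row t == i]|.
Proof. by rewrite row_filledE card_in_imset //; apply: col_inj_row. Qed.

Lemma array_of_col_card j :
  #|[set i | isSome (array_of i j)]| = #|[set t | col t == j]|.
Proof. by rewrite col_filledE card_in_imset //; apply: row_inj_col. Qed.

Lemma array_of_row_sum i :
  (\sum_(j | isSome (array_of i j)) odflt 0 (array_of i j)
   = \sum_(t | row t == i) v t)%R.
Proof.
rewrite -(eq_bigl _ _ (in_set (fun j => isSome (array_of i j)))) row_filledE.
rewrite big_imset /=; last exact: col_inj_row.
by apply: eq_big => t; rewrite inE // => /eqP <-; rewrite array_of_cell.
Qed.

Lemma array_of_col_sum j :
  (\sum_(i | isSome (array_of i j)) odflt 0 (array_of i j)
   = \sum_(t | col t == j) v t)%R.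
Proof.
rewrite -(eq_bigl _ _ (in_set (fun i => isSome (array_of i j)))) col_filledE.
rewrite big_imset /=; last exact: row_inj_col.
by apply: eq_big => t; rewrite inE // => /eqP <-; rewrite array_of_cell.
Qed.

Lemma array_of_value_card x :
  #|[set p | array_of p.1 p.2 == Some x]| = #|[set t | v t == x]|.
Proof.
rewrite -(card_imset _ placement_inj); apply: eq_card => -[i j]; rewrite inE /=.
apply/idP/imsetP => [/eqP Aij|[t]]; last first.
  by rewrite inE => /eqP <- [-> ->]; rewrite array_of_cell.
have [|t rt ct] := @array_of_filled i j; first by rewrite Aij.
exists t; last by rewrite rt ct.
by move: Aij; rewrite inE -rt -ct array_of_cell => -[->].
Qed.

End ArrayOfPlacement.

(** * Blocks of four and residue classes of positions *)

(** The last case forces 4 to divide the length, so that blocks stay aligned under concatenation. *)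
Fixpoint chunks0 (L : seq int) : bool :=
  match L with
  | [::] => true
  | [:: a, b, c, d & L'] => ((a + b + c + d)%R == 0%R) && chunks0 L'
  | _ => false
  end.

Lemma chunks0_cat L L' : chunks0 L -> chunks0 (L ++ L') = chunks0 L'.
Proof.
have [l] := ubnP (size L); elim: l L => // l IHl [|a [|b [|c [|d L]]]] //= sz.
by case/andP=> -> cL; rewrite IHl //; lia.
Qed.

(** An arbitrary [Q] on block indices lets the induction drop one block and pass to [Q \o succn]. A
    row of the array is later one such choice of [Q]. *)
Lemma chunks0_sum (Q : pred nat) L : chunks0 L ->
  (\sum_(p < size L | Q (p %/ 4)%N) nth 0 L p = 0)%R.
Proof.
have [l] := ubnP (size L); elim: l L Q => // l IHl [|a [|b [|c [|d L]]]] //= Q sz.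
  by rewrite big_ord0.
case/andP=> /eqP abcd cL; rewrite big_mkcond !big_ord_recl /=.
rewrite -[X in (_ + (_ + (_ + (_ + X))))%R = _]big_mkcond /=.
rewrite (eq_bigl (fun p : 'I_(size L) => (Q \o succn) (p %/ 4))); last first.
  by move=> p; rewrite /= /bump /= !add1n; congr Q; lia.
rewrite IHl //; last by lia.
(* The first four terms carry the same condition [Q 0], so they are kept or dropped together. *)
by case: ifP => _; rewrite ?addr0 // !addrA.
Qed.

Definition colsum n j (L : seq int) : int :=
  (\sum_(p < size L | (p %% n)%N == j) nth 0 L p)%R.

Lemma colsum_cat n j L L' : n %| size L ->
  colsum n j (L ++ L') = (colsum n j L + colsum n j L')%R.
Proof.
move=> nL; rewrite /colsum size_cat big_split_ord /=; congr (_ + _)%R.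
  by apply: eq_bigr => p _; rewrite nth_cat ltn_ord.
apply: eq_big => [p|p _]; first by rewrite -modnDml (eqP nL).
by rewrite nth_cat ltnNge leq_addr /= addKn.
Qed.

Lemma colsum_opp n j (L : seq int) : (colsum n j [seq - x | x <- L] = - colsum n j L)%R.
Proof.
rewrite /colsum size_map raddf_sum /=.
by apply: eq_bigr => p _; rewrite (nth_map 0%R).
Qed.

Lemma colsum_nth n j L : size L = n -> j < n -> colsum n j L = nth 0%R L j.
Proof.
move=> szL jn; rewrite /colsum szL (bigD1 (Ordinal jn)) /= ?modn_small //.
rewrite big1 ?addr0 // => p /andP[/eqP pj /eqP[]]; apply/val_inj => /=.
by rewrite -pj modn_small.
Qed.

(** * Signed copies of an interval, and layouts *)

Definition pm (S : seq nat) : seq int :=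
  [seq x%:Z%R | x <- S] ++ [seq (- x%:Z)%R | x <- S].

Lemma perm_pm S S' : perm_eq S S' -> perm_eq (pm S) (pm S').
Proof. by move=> SS'; rewrite /pm perm_cat // perm_map. Qed.

Lemma pm_cat S S' : perm_eq (pm (S ++ S')) (pm S ++ pm S').
Proof. by rewrite /pm !map_cat perm_catACA. Qed.

Lemma pm_abs (L : seq int) :
  perm_eq (L ++ [seq (- x)%R | x <- L]) (pm [seq `|x|%N | x <- L]).
Proof.
elim: L => //= x L /permP IHL; apply/permP => a; move: (IHL a).
rewrite /pm /= !count_cat /= => {}IHL.
have /orP[/eqP->|/eqP xE] : (x == `|x|%N%:Z%R) || (x == - `|x|%N%:Z%R)%R by lia.
  by rewrite absz_nat; lia.
rewrite {1 2}xE opprK; lia.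
Qed.

Lemma mem_pm_iota x M : (x \in pm (iota 1 M)) = (x != 0%R) && (`|x|%N <= M).
Proof.
rewrite mem_cat; apply/orP/idP => [[]/mapP[y]|/andP[x0 xM]].
- by rewrite mem_iota => yM ->; lia.
- by rewrite mem_iota => yM ->; lia.
have /orP[/eqP xE|/eqP xE] : (x == `|x|%N%:Z%R) || (x == - `|x|%N%:Z%R)%R by lia.
  by left; rewrite xE map_f // mem_iota; lia.
by right; rewrite xE (map_f (fun y : nat => - y%:Z)%R) // mem_iota; lia.
Qed.

Lemma pm_iota_uniq M : uniq (pm (iota 1 M)).
Proof.
rewrite cat_uniq !map_inj_uniq ?iota_uniq /= ?andbT; try by move=> x y; lia.
by apply/hasPn => x /mapP[y]; rewrite mem_iota => yM ->; apply/mapP => -[z]; lia.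
Qed.

(** The offset [o] makes layouts stackable: absolute values [o + 1, ..., o + l] are used up, and the
    next piece starts from [o + l]. *)
Definition layout n o l (L : seq int) : Prop :=
  [/\ n %| size L, chunks0 L, forall j, j < n -> colsum n j L = 0%R
    & perm_eq L (pm (iota o.+1 l))].

Lemma layout_nil n o : layout n o 0 [::].
Proof. by split=> // j _; rewrite /colsum big_ord0. Qed.

Lemma layout_cat n o l l' L L' :
  layout n o l L -> layout n (o + l) l' L' -> layout n o (l + l') (L ++ L').
Proof.
move=> [nL cL sL pL] [nL' cL' sL' pL']; split.
- by rewrite size_cat dvdn_add.
- by rewrite chunks0_cat.
- by move=> j jn; rewrite colsum_cat // sL ?sL'.
- rewrite iotaD perm_sym (perm_trans (pm_cat _ _)) // perm_sym.
  by apply: perm_cat; rewrite // addSn.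
Qed.

(** * Alternating pieces, enough for k even *)

(** Built from [g] pairs of consecutive numbers with opposite signs: the pair sums are 1 and -1
    alternately, so two successive pairs form a block of sum 0. *)
Fixpoint zigzag (b : bool) o g : seq int :=
  if g is g'.+1
  then [:: ((-1) ^+ b * o.+1%:Z)%R, (- ((-1) ^+ b * o.+2%:Z))%R
         & zigzag (~~ b) o.+2 g']
  else [::].

Lemma abs_zigzag b o g : [seq `|x|%N | x <- zigzag b o g] = iota o.+1 g.*2.
Proof. by elim: g b o => //= g IHg b o; rewrite IHg abszN !abszMsign. Qed.

Lemma size_zigzag b o g : size (zigzag b o g) = g.*2.
Proof. by rewrite -(size_map absz) abs_zigzag size_iota. Qed.

Lemma zigzag_opp b o g :
  [seq (- x)%R | x <- zigzag b o g] = zigzag (~~ b) o g.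
Proof.
elim: g b o => //= g IHg b o.
by rewrite IHg; case: b => /=; do 2?congr cons; lia.
Qed.

Lemma zigzagD b o g g' :
  zigzag b o (g + g') = zigzag b o g ++ zigzag (b (+) odd g) (o + g.*2) g'.
Proof.
elim: g b o => [|g IHg] b o /=; first by rewrite addbF addn0.
by rewrite IHg addbN addNb !addSnnS.
Qed.

Lemma chunks0_zigzag b o g : ~~ odd g -> chunks0 (zigzag b o g).
Proof.
have [l] := ubnP g; elim: l g b o => // l IHl [|[|g]] //= b o gl; rewrite negbK => og.
by rewrite negbK IHl ?andbT //; [case: b; rewrite expr0 expr1; lia|lia].
Qed.

(** For [g] odd one block straddles the junction: the last pair has sign [b], the first pair of the
    negated copy has sign [~~ b], and their sums cancel. *)
Lemma chunks0_zigzag_opp b o g :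
  chunks0 (zigzag b o g ++ [seq (- x)%R | x <- zigzag b o g]).
Proof.
rewrite zigzag_opp; have [og|eg] := boolP (odd g); last first.
  by rewrite chunks0_cat chunks0_zigzag.
case: g og => // g og; have eg : ~~ odd g by [].
rewrite -[zigzag b o _]/(zigzag b o g.+1) -addn1 zigzagD addn1 (negbTE eg) addbF -catA.
rewrite chunks0_cat ?chunks0_zigzag //= chunks0_zigzag // andbT.
by case: b; rewrite expr0 expr1; lia.
Qed.

Lemma layout_zigzag n o g : n %| g.*2 ->
  layout n o g.*2
    (zigzag true o g ++ [seq (- x)%R | x <- zigzag true o g]).
Proof.
move=> ng; split.
- by rewrite size_cat size_map size_zigzag dvdn_add.
- exact: chunks0_zigzag_opp.
- by move=> j _; rewrite colsum_cat ?size_zigzag // colsum_opp subrr.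
- by rewrite -(abs_zigzag true) pm_abs.
Qed.

Lemma layout_even n o g c : n %| g.*2 -> exists L, layout n o (c * g.*2) L.
Proof.
move=> ng; elim: c o => [|c IHc] o; first by exists [::]; apply: layout_nil.
have [L' lL'] := IHc (o + g.*2).
by exists (zigzag true o g ++ [seq (- x)%R | x <- zigzag true o g] ++ L');
  rewrite catA mulSn; apply: layout_cat => //; apply: layout_zigzag.
Qed.

(** * Three full rows given by their columns *)

Definition three_rows (C : seq (int * int * int)) : seq int :=
  [seq c.1.1 | c <- C] ++ [seq c.1.2 | c <- C] ++ [seq c.2 | c <- C].

Lemma three_rows_cat C C' :
  perm_eq (three_rows (C ++ C')) (three_rows C ++ three_rows C').
Proof. by apply/permP => a; rewrite /three_rows !map_cat !count_cat; lia. Qed.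

(** Each row has length [size C], so residue classes of positions modulo [size C] are exactly the
    columns in [C]. *)
Lemma layout_three_rows C l :
  chunks0 [seq c.1.1 | c <- C] -> chunks0 [seq c.1.2 | c <- C] ->
  chunks0 [seq c.2 | c <- C] ->
  all (fun c : int * int * int => c.1.1 + c.1.2 + c.2 == 0)%R C ->
  perm_eq (three_rows C) (pm (iota 1 l)) -> layout (size C) 0 l (three_rows C).
Proof.
move=> c1 c2 c3 /(all_nthP (0, 0, 0)%R) zC pC; split=> //.
- by rewrite !size_cat !size_map !dvdn_add.
- by rewrite !chunks0_cat.
- move=> j jC; rewrite !colsum_cat ?size_map // !colsum_nth ?size_map //.
  by rewrite !(nth_map (0, 0, 0)%R) // addrA (eqP (zC j jC)).
Qed.

Definition entries (ts : seq (nat * nat * nat)) : seq nat :=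
  flatten [seq [:: t.1.1; t.1.2; t.2] | t <- ts].

Lemma mem_entries ts a b c x :
  (a, b, c) \in ts -> [\/ x = a, x = b | x = c] -> x \in entries ts.
Proof.
move=> ts_t x_t; apply/flatten_mapP; exists (a, b, c) => //.
by rewrite !inE; case: x_t => ->; rewrite eqxx ?orbT.
Qed.

Lemma size_entries ts : size (entries ts) = 3 * size ts.
Proof. by rewrite /entries; elim: ts => //= t ts ->; lia. Qed.

Definition opposite_columns (ts : seq (nat * nat * nat)) :
    seq (int * int * int) :=
  flatten [seq [:: (t.1.1%:Z, t.1.2%:Z, - t.2%:Z);
                   (- t.1.1%:Z, - t.1.2%:Z, t.2%:Z)]%R | t <- ts].

Lemma size_opposite_columns ts : size (opposite_columns ts) = (size ts).*2.
Proof. by rewrite /opposite_columns; elim: ts => //= t ts ->. Qed.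

Lemma chunks0_opposite_columns ts : ~~ odd (size ts) ->
  [/\ chunks0 [seq c.1.1 | c <- opposite_columns ts],
      chunks0 [seq c.1.2 | c <- opposite_columns ts]
    & chunks0 [seq c.2 | c <- opposite_columns ts]].
Proof.
have [l] := ubnP (size ts); elim: l ts => // l IHl [|t [|u ts]] //= sz.
rewrite negbK => ev; have [|-> -> ->] := IHl ts _ ev; first by lia.
by rewrite !andbT; split; apply/eqP; ring.
Qed.

Lemma opposite_columns_sum ts : all (fun t => t.1.1 + t.1.2 == t.2) ts ->
  all (fun c : int * int * int => c.1.1 + c.1.2 + c.2 == 0)%R
      (opposite_columns ts).
Proof. by elim: ts => //= t ts IHts /andP[/eqP tE /IHts->]; rewrite andbT; lia. Qed.

Lemma three_rows_opposite_columns ts :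
  perm_eq (three_rows (opposite_columns ts)) (pm (entries ts)).
Proof.
elim: ts => //= t ts /permP IHts; apply/permP => a; move: (IHts a).
by rewrite /three_rows /pm !count_cat /= -/(opposite_columns ts) -/(entries ts); lia.
Qed.

(** * Partitions of intervals into triples a + b = c *)

(** At most [l] terms covering [l] distinct numbers leave no room for repetitions or other values.
    The partitions below thus reduce to a count and a covering check. *)
Lemma perm_iota_of_subset (S : seq nat) l :
  {subset iota 1 l <= S} -> size S <= l -> perm_eq S (iota 1 l).
Proof.
move=> sub szS; rewrite perm_sym.
have szS' : size S <= size (iota 1 l) by rewrite size_iota.
have [eqsz memS] := uniq_min_size (iota_uniq 1 l) sub szS'.
by apply: uniq_perm; rewrite ?iota_uniq // -(eq_uniq eqsz memS) iota_uniq.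
Qed.

(* The differences 2j and 2j - 1 are realised by pairs symmetric around 6u and
   10u - 1/2; the two listed triples absorb the differences 2u and 4u, the pair
   5u, 7u, the centre 6u and the endpoint 12u. *)
Definition triples_even u : seq (nat * nat * nat) :=
  [:: (5 * u, 7 * u, 12 * u); (2 * u, 4 * u, 6 * u)]
  ++ [seq (2 * j, 6 * u - j, 6 * u + j) | j <- iota 1 u.-1 ++ iota u.+1 u.-1]
  ++ [seq (2 * j - 1, 10 * u - j, 10 * u + j - 1) | j <- iota 1 (2 * u)].

Lemma triples_even_sum u :
  all (fun t => t.1.1 + t.1.2 == t.2) (triples_even u).
Proof.
rewrite /triples_even !all_cat !all_map; apply/and3P; split; first by rewrite /=; lia.
  by apply/allP => j; rewrite mem_cat !mem_iota /=; lia.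
by apply/allP => j; rewrite mem_iota /=; lia.
Qed.

Lemma size_triples_even u : 0 < u -> size (triples_even u) = 4 * u.
Proof. by move=> u0; rewrite !size_cat !size_map size_cat !size_iota /=; lia. Qed.

(** Up to 4u, parity decides which family has [x] as its difference. Beyond, [x] lies in one of the
    halves (4u, 6u), (6u, 8u), [8u, 10u), [10u, 12u) around the two centres, apart from the
    exceptional values in [inL]. *)
Lemma perm_triples_even u : 0 < u ->
  perm_eq (entries (triples_even u)) (iota 1 (12 * u)).
Proof.
move=> u0; apply: perm_iota_of_subset; last first.
  by rewrite size_entries size_triples_even //; lia.
move=> x; rewrite mem_iota => xu.
have inL y : y \in [:: 5 * u; 7 * u; 12 * u; 2 * u; 4 * u; 6 * u] ->
    y \in entries (triples_even u).
  by move=> yL; rewrite (mem_cat y [:: _; _; _; _; _; _]) yL.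
have inD j y : 0 < j < 2 * u -> j != u ->
    [\/ y = 2 * j, y = 6 * u - j | y = 6 * u + j] -> y \in entries (triples_even u).
  move=> ju nu; apply: mem_entries.
  rewrite !mem_cat; apply/or3P/Or32/mapP; exists j => //.
  by rewrite mem_cat !mem_iota; lia.
have inO j y : 0 < j <= 2 * u ->
    [\/ y = 2 * j - 1, y = 10 * u - j | y = 10 * u + j - 1] ->
    y \in entries (triples_even u).
  move=> ju; apply: mem_entries.
  by rewrite !mem_cat; apply/or3P/Or33/mapP; exists j => //; rewrite mem_iota; lia.
have [x4|x4] := leqP x (4 * u).
  have [ox|ex] := boolP (odd x).
    by apply: (inO x.+1./2); [lia | apply: Or31; lia].
  have [xE|?] := eqVneq x (2 * u); first by apply: inL; rewrite xE !inE eqxx ?orbT.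
  have [xE|?] := eqVneq x (4 * u); first by apply: inL; rewrite xE !inE eqxx ?orbT.
  by apply: (inD x./2); [lia | lia | apply: Or31; lia].
have [x6|x6] := leqP x (6 * u).
  have [xE|?] := eqVneq x (5 * u); first by apply: inL; rewrite xE !inE eqxx ?orbT.
  have [xE|?] := eqVneq x (6 * u); first by apply: inL; rewrite xE !inE eqxx ?orbT.
  by apply: (inD (6 * u - x)); [lia | lia | apply: Or32; lia].
have [x8|x8] := ltnP x (8 * u).
  have [xE|?] := eqVneq x (7 * u); first by apply: inL; rewrite xE !inE eqxx ?orbT.
  by apply: (inD (x - 6 * u)); [lia | lia | apply: Or33; lia].
have [x10|x10] := ltnP x (10 * u).
  by apply: (inO (10 * u - x)); [lia | apply: Or32; lia].
have [xE|?] := eqVneq x (12 * u); first by apply: inL; rewrite xE !inE eqxx ?orbT.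
by apply: (inO (x - 10 * u + 1)); [lia | apply: Or33; lia].
Qed.

(* A hooked Skolem sequence of order 4s + 2 with its exceptional triples rearranged
   so that the numbers left over in [1, 12s + 6] are a, b, x, x + a, x + b, x + a + b
   for a = 1, b = 8s + 4 and x = 2s. *)
Definition triples_odd s : seq (nat * nat * nat) :=
  [:: (4 * s + 2, 7 * s + 3, 11 * s + 5); (5 * s + 3, 6 * s + 3, 11 * s + 6);
      (4 * s + 1, 8 * s + 5, 12 * s + 6)]
  ++ [seq (4 * s + 2 - 2 * r, 4 * s + 2 + r, 8 * s + 4 - r)
     | r <- iota 1 s ++ iota s.+2 s.-1]
  ++ [seq (4 * s + 1 - 2 * r, 8 * s + 5 + r, 12 * s + 6 - r) | r <- iota 1 s.-1]
  ++ [seq (2 * s + 1 - 2 * r, 9 * s + 4 + r, 11 * s + 5 - r) | r <- iota 1 s.-1].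

Lemma triples_odd_sum s :
  all (fun t => t.1.1 + t.1.2 == t.2) (triples_odd s).
Proof.
rewrite /triples_odd !all_cat !all_map; apply/and4P; split; first by rewrite /=; lia.
- by apply/allP => r; rewrite mem_cat !mem_iota /=; lia.
- by apply/allP => r; rewrite mem_iota /=; lia.
- by apply/allP => r; rewrite mem_iota /=; lia.
Qed.

Lemma size_triples_odd s : 0 < s -> size (triples_odd s) = 4 * s.
Proof. by move=> s0; rewrite !size_cat !size_map size_cat !size_iota /=; lia. Qed.

(** Up to 4s, even [x] come from the first family, odd [x] from the third below 2s and from the
    second above. Larger [x] are located by intervals, and [inL] catches the exceptions. *)
Lemma perm_triples_odd s : 0 < s ->
  perm_eq ([:: 1; 8 * s + 4; 2 * s; 2 * s + 1; 10 * s + 4; 10 * s + 5]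
           ++ entries (triples_odd s))
          (iota 1 (12 * s + 6)).
Proof.
move=> s0; apply: perm_iota_of_subset; last first.
  by rewrite size_cat size_entries size_triples_odd //=; lia.
move=> x; rewrite mem_iota => xs.
set E := _ ++ _.
(* The six numbers set aside and the nine entries of the exceptional triples form a prefix of
   [E]. *)
have inL y : y \in [:: 1; 8 * s + 4; 2 * s; 2 * s + 1; 10 * s + 4; 10 * s + 5;
    4 * s + 2; 7 * s + 3; 11 * s + 5; 5 * s + 3; 6 * s + 3; 11 * s + 6;
    4 * s + 1; 8 * s + 5; 12 * s + 6] -> y \in E.
  move=> yL.
  by rewrite (mem_cat y [:: _; _; _; _; _; _; _; _; _; _; _; _; _; _; _]) yL.
have inE3 a b c y : (a, b, c) \in triples_odd s ->
    [\/ y = a, y = b | y = c] -> y \in E.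
  by move=> abc yabc; rewrite mem_cat (mem_entries abc yabc) orbT.
(* For [r = s + 1] the triple would be 2s, 5s + 3, 7s + 3: the first is the [x] set aside, the
   others belong to exceptional triples. *)
have inA r y : 0 < r <= 2 * s -> r != s.+1 ->
    [\/ y = 4 * s + 2 - 2 * r, y = 4 * s + 2 + r | y = 8 * s + 4 - r] -> y \in E.
  move=> rs nr; apply: inE3.
  rewrite !mem_cat; apply/or4P/Or42/mapP; exists r => //.
  by rewrite mem_cat !mem_iota; lia.
have inB r y : 0 < r < s ->
    [\/ y = 4 * s + 1 - 2 * r, y = 8 * s + 5 + r | y = 12 * s + 6 - r] -> y \in E.
  move=> rs; apply: inE3.
  by rewrite !mem_cat; apply/or4P/Or43/mapP; exists r => //; rewrite mem_iota; lia.
have inC r y : 0 < r < s ->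
    [\/ y = 2 * s + 1 - 2 * r, y = 9 * s + 4 + r | y = 11 * s + 5 - r] -> y \in E.
  move=> rs; apply: inE3.
  by rewrite !mem_cat; apply/or4P/Or44/mapP; exists r => //; rewrite mem_iota; lia.
have [x4|x4] := leqP x (4 * s).
  have [ox|ex] := boolP (odd x); last first.
    have [xE|?] := eqVneq x (2 * s); first by apply: inL; rewrite xE !inE eqxx ?orbT.
    by apply: (inA (2 * s + 1 - x./2)); [lia | lia | apply: Or31; lia].
  have [x2|x2] := ltnP x (2 * s).
    have [xE|?] := eqVneq x 1; first by apply: inL; rewrite xE !inE eqxx ?orbT.
    by apply: (inC (s - x./2)); [lia | apply: Or31; lia].
  have [xE|?] := eqVneq x (2 * s + 1); first by apply: inL; rewrite xE !inE eqxx ?orbT.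
  by apply: (inB (2 * s - x./2)); [lia | apply: Or31; lia].
have [x6|x6] := leqP x (6 * s + 2).
  have [xE|?] := eqVneq x (4 * s + 1); first by apply: inL; rewrite xE !inE eqxx ?orbT.
  have [xE|?] := eqVneq x (4 * s + 2); first by apply: inL; rewrite xE !inE eqxx ?orbT.
  have [xE|?] := eqVneq x (5 * s + 3); first by apply: inL; rewrite xE !inE eqxx ?orbT.
  by apply: (inA (x - (4 * s + 2))); [lia | lia | apply: Or32; lia].
have [x8|x8] := leqP x (8 * s + 4).
  have [xE|?] := eqVneq x (6 * s + 3); first by apply: inL; rewrite xE !inE eqxx ?orbT.
  have [xE|?] := eqVneq x (7 * s + 3); first by apply: inL; rewrite xE !inE eqxx ?orbT.
  have [xE|?] := eqVneq x (8 * s + 4); first by apply: inL; rewrite xE !inE eqxx ?orbT.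
  by apply: (inA (8 * s + 4 - x)); [lia | lia | apply: Or33; lia].
have [x9|x9] := leqP x (9 * s + 4).
  have [xE|?] := eqVneq x (8 * s + 5); first by apply: inL; rewrite xE !inE eqxx ?orbT.
  by apply: (inB (x - (8 * s + 5))); [lia | apply: Or32; lia].
have [x10|x10] := leqP x (10 * s + 4).
  have [xE|?] := eqVneq x (10 * s + 4); first by apply: inL; rewrite xE !inE eqxx ?orbT.
  by apply: (inC (x - (9 * s + 4))); [lia | apply: Or32; lia].
have [x11|x11] := leqP x (11 * s + 5).
  have [xE|?] := eqVneq x (10 * s + 5); first by apply: inL; rewrite xE !inE eqxx ?orbT.
  have [xE|?] := eqVneq x (11 * s + 5); first by apply: inL; rewrite xE !inE eqxx ?orbT.
  by apply: (inC (11 * s + 5 - x)); [lia | apply: Or33; lia].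
have [xE|?] := eqVneq x (11 * s + 6); first by apply: inL; rewrite xE !inE eqxx ?orbT.
have [xE|?] := eqVneq x (12 * s + 6); first by apply: inL; rewrite xE !inE eqxx ?orbT.
by apply: (inB (12 * s + 6 - x)); [lia | apply: Or33; lia].
Qed.

(* Unlike opposite columns, these use the six absolute values
   a, b, x, x + a, x + b, x + a + b even when their sum is odd. *)
Definition cyclic_columns (a b x : nat) : seq (int * int * int) :=
  [:: ((x + b)%:Z, - (x + a + b)%:Z, a%:Z);
      (- (x + b)%:Z, x%:Z, b%:Z);
      (- (x + a)%:Z, (x + a + b)%:Z, - b%:Z);
      ((x + a)%:Z, - x%:Z, - a%:Z)]%R.

Lemma cyclic_columns_chunks0 a b x :
  [/\ chunks0 [seq c.1.1 | c <- cyclic_columns a b x],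
      chunks0 [seq c.1.2 | c <- cyclic_columns a b x]
    & chunks0 [seq c.2 | c <- cyclic_columns a b x]].
Proof. by split=> /=; lia. Qed.

Lemma cyclic_columns_sum a b x :
  all (fun c : int * int * int => c.1.1 + c.1.2 + c.2 == 0)%R
      (cyclic_columns a b x).
Proof. by rewrite /=; lia. Qed.

Lemma three_rows_cyclic_columns a b x :
  perm_eq (three_rows (cyclic_columns a b x))
          (pm [:: a; b; x; x + a; x + b; x + a + b]).
Proof. by apply/permP => p /=; lia. Qed.

(** * Existence of layouts *)

Lemma layout_three h : 0 < h -> exists L, layout (4 * h) 0 (6 * h) L.
Proof.
move=> h0; have [oh|eh] := boolP (odd h); last first.
  set u := h./2; have hE : h = 2 * u by rewrite /u; lia.
  have u0 : 0 < u by lia.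
  have [|c1 c2 c3] := @chunks0_opposite_columns (triples_even u).
    by rewrite size_triples_even //; lia.
  exists (three_rows (opposite_columns (triples_even u))).
  have -> : 4 * h = size (opposite_columns (triples_even u)).
    by rewrite size_opposite_columns size_triples_even //; lia.
  apply: layout_three_rows => //.
    exact/opposite_columns_sum/triples_even_sum.
  rewrite (perm_trans (three_rows_opposite_columns _)) // perm_pm //.
  by rewrite (perm_trans (perm_triples_even _)) //; have -> : 12 * u = 6 * h by lia.
have [->|h1] := eqVneq h 1.
  (* With a = 1, b = 2, x = 3 the six absolute values are exactly 1, ..., 6, and no triples
     remain. *)
  exists (three_rows (cyclic_columns 1 2 3)).
  have [c1 c2 c3] := cyclic_columns_chunks0 1 2 3.
  exact: (@layout_three_rows (cyclic_columns 1 2 3)).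
set s := h./2; have hE : h = 2 * s + 1 by rewrite /s; lia.
have s0 : 0 < s by lia.
have [|c1 c2 c3] := @chunks0_opposite_columns (triples_odd s).
  by rewrite size_triples_odd //; lia.
have [d1 d2 d3] := cyclic_columns_chunks0 1 (8 * s + 4) (2 * s).
(* The cyclic columns fill one block in each row, so the blocks of the 8s opposite columns stay
   aligned. *)
pose C := cyclic_columns 1 (8 * s + 4) (2 * s) ++ opposite_columns (triples_odd s).
exists (three_rows C).
have -> : 4 * h = size C.
  by rewrite size_cat size_opposite_columns size_triples_odd //=; lia.
apply: layout_three_rows; try by rewrite map_cat chunks0_cat.
  by rewrite all_cat cyclic_columns_sum opposite_columns_sum ?triples_odd_sum.
rewrite (perm_trans (three_rows_cat _ _)) //.
have -> : 6 * h = 12 * s + 6 by lia.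
apply: perm_trans (perm_pm (perm_triples_odd s0)).
rewrite perm_sym (perm_trans (pm_cat _ _)) // perm_sym perm_cat //.
  apply: perm_trans (three_rows_cyclic_columns _ _ _) _.
  have -> : 2 * s + (8 * s + 4) = 10 * s + 4 by lia.
  by have -> : 2 * s + 1 + (8 * s + 4) = 10 * s + 5 by lia.
exact: three_rows_opposite_columns.
Qed.

(** If k is odd, 4 divides n and three full rows precede the symmetric pieces. If k is even, X has
    length n for n even, but 2n for n odd since X consists of pairs; then 4 divides k and k / 4
    pieces of 4n entries fit. *)
Lemma layout_exists n k :
  3 < n -> 2 < k -> 4 %| n * k -> exists L, layout n 0 (n * k)./2 L.
Proof.
move=> n3 k2 nk4.
have co4 x : odd x -> coprime 4 x.
  by move=> ox; rewrite -[4]/(2 ^ 2) coprimeXl // coprime2n.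
have [ok|ek] := boolP (odd k).
  have n4 : 4 %| n by rewrite -(Gauss_dvdl _ (co4 _ ok)).
  have [h nE] : exists h, n = 4 * h by exists (n %/ 4); lia.
  have [|L lL] := @layout_three h; first by lia.
  rewrite -nE in lL.
  (* The offset 6h skips the absolute values taken by the three rows. *)
  have [|L' lL'] := @layout_even n (6 * h) (2 * h) (k - 3)./2.
    by have -> : (2 * h).*2 = n by lia.
  exists (L ++ L').
  have kE : k = (k - 3)./2.*2 + 3 by lia.
  have -> : n * k = (6 * h + (k - 3)./2 * (2 * h).*2).*2.
    by rewrite nE {1}kE -!muln2; lia.
  by rewrite doubleK; apply: layout_cat.
have [on|en] := boolP (odd n).
  have k4 : 4 %| k by rewrite -(Gauss_dvdr _ (co4 _ on)).
  have [|L lL] := @layout_even n 0 n (k %/ 4); first by rewrite -muln2 dvdn_mulr.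
  exists L; have -> : n * k = (k %/ 4 * n.*2).*2.
    by rewrite -[in LHS](divnK k4) -!muln2; lia.
  by rewrite doubleK.
have [|L lL] := @layout_even n 0 n./2 k./2; first by have -> : n./2.*2 = n by lia.
exists L; have -> : n * k = (k./2 * n./2.*2).*2.
  by rewrite -[in LHS](even_halfK ek) -[in LHS](even_halfK en) -!muln2; lia.
by rewrite doubleK.
Qed.

(** * Rows and columns of the placement p -> (p / s, p mod n) *)

Lemma card_div_fiber N m s (i : 'I_m) :
  N = m * s -> #|[set p : 'I_N | p %/ s == i]| = s.
Proof.
move=> ->.
have lt_f (r : 'I_s) : i * s + r < m * s.
  by rewrite (leq_trans (n := i.+1 * s)) ?leq_mul // mulSn addnC ltn_add2r.
rewrite -[RHS]card_ord -(card_imset _ (f := fun r => Ordinal (lt_f r))); last first.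
  by move=> r r' [] /addnI /val_inj.
apply: eq_card => p; rewrite inE; apply/eqP/imsetP => [pi|[r _ ->] /=]; last first.
  by rewrite divnMDl ?divn_small ?addn0 //; case: r; case: (s).
have s0 : 0 < s by case: (s) p {lt_f pi} => // -[p]; rewrite muln0.
exists (Ordinal (ltn_pmod p s0)) => //.
by apply/val_inj; rewrite /= -pi -divn_eq.
Qed.

Lemma card_mod_fiber n k (j : 'I_n) :
  #|[set p : 'I_(n * k) | p %% n == j]| = k.
Proof.
have n0 : 0 < n by apply: leq_ltn_trans (ltn_ord j).
have lt_f (r : 'I_k) : r * n + j < n * k.
  by rewrite [n * k]mulnC (leq_trans (n := r.+1 * n)) ?leq_mul // mulSn addnC ltn_add2r.
rewrite -[RHS]card_ord -(card_imset _ (f := fun r => Ordinal (lt_f r))); last first.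
  move=> r r' [] /addIn /eqP; rewrite eqn_pmul2r // => /eqP; exact: val_inj.
apply: eq_card => p; rewrite inE; apply/eqP/imsetP => [pj|[r _ ->] /=]; last first.
  by rewrite modnMDl modn_small.
have ltp : p %/ n < k by rewrite ltn_divLR // [k * n]mulnC ltn_ord.
exists (Ordinal ltp) => //.
by apply/val_inj; rewrite /= -pj -divn_eq.
Qed.

(** Equal quotients by [s] put the two positions at distance less than [s <= n], while equal
    residues make [n] divide that distance. *)
Lemma div_mod_inj n s p q :
  0 < s <= n -> p %/ s = q %/ s -> p %% n = q %% n -> p = q.
Proof.
case/andP=> s0 sn; wlog pq : p q / p <= q => [wl dpq mpq|].
  by case/orP: (leq_total p q) => le_pq; [|apply/esym]; apply: wl.
move=> dpq /esym /eqP; rewrite eqn_mod_dvd // => ndvd.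
have lt_n : q - p < n.
  by apply: leq_trans sn; have := divn_eq p s; have := divn_eq q s;
     have := ltn_pmod p s0; have := ltn_pmod q s0; rewrite dpq; lia.
have /eqP : q - p == 0 by rewrite -(modn_small lt_n).
lia.
Qed.

(** * Assembling the signed magic array *)

Theorem theorem1p10 (m n s k : nat)
  (hs3 : 3 <= s) (hsn : s <= n) (hk3 : 3 <= k) (hkm : k <= m)
  (hmsnk : m * s = n * k) (hs4 : s = 0 %[mod 4]) :
  exists A : pf_array m n, signed_magic_array s k A.
Proof.
have s4 : 4 %| s by rewrite /dvdn hs4.
have nk4 : 4 %| n * k by rewrite -hmsnk dvdn_mull.
have n4 : 3 < n by lia.
have [L [nL cL sL pL]] := layout_exists n4 hk3 nk4.
set M := (n * k)./2 in pL.
have nkE : n * k = M.*2 by rewrite /M -hmsnk; lia.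
have szL : size L = n * k.
  by rewrite (perm_size pL) size_cat !size_map size_iota nkE addnn.
have uL : uniq L by rewrite (perm_uniq pL) pm_iota_uniq.
(* As nk is even, [Omega] is the variant without 0, with bound [M]. *)
have OmegaE x : Omega (n * k) x = (x \in L).
  by rewrite (perm_mem pL) mem_pm_iota /Omega nkE odd_double doubleK.
have n0 : 0 < n by lia.
have ltrow (p : 'I_(n * k)) : p %/ s < m by rewrite ltn_divLR ?hmsnk ?ltn_ord //; lia.
pose row p := Ordinal (ltrow p).
pose col (p : 'I_(n * k)) := Ordinal (ltn_pmod p n0).
pose v (p : 'I_(n * k)) := nth 0%R L p.
have inj : injective (fun p => (row p, col p)).
  by move=> p q [dpq mpq]; apply/val_inj/(div_mod_inj _ dpq mpq); lia.
exists (array_of row col v); split.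
- move=> i j x Aij; have [|p rp cp] := @array_of_filled _ _ _ row col v i j.
    by rewrite Aij.
  move: Aij; rewrite -rp -cp array_of_cell // => -[<-].
  by rewrite OmegaE mem_nth ?szL.
- move=> i; rewrite array_of_row_card // -[RHS](card_div_fiber i (esym hmsnk)).
  by apply: eq_card => p; rewrite !inE.
- move=> j; rewrite array_of_col_card // -[RHS](card_mod_fiber k j).
  by apply: eq_card => p; rewrite !inE.
- move=> x; rewrite OmegaE => xL; rewrite array_of_value_card //.
  have ltx : index x L < n * k by rewrite -szL index_mem.
  rewrite -(cards1 (Ordinal ltx)); apply: eq_card => p; rewrite !inE.
  apply/eqP/eqP => [vpx|->]; last exact: nth_index.
  by apply/val_inj; rewrite /= -vpx index_uniq ?szL.
- move=> i; rewrite array_of_row_sum //.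
  (* Since 4 divides [s], p / s = (p / 4) / (s / 4): row [i] is a union of blocks. *)
  have := @chunks0_sum (fun q => q %/ (s %/ 4) == i) L cL.
  rewrite szL => sumE; rewrite -[RHS]sumE.
  by apply: eq_bigl => p; rewrite -divnMA [4 * _]mulnC divnK.
- move=> j; rewrite array_of_col_sum //.
  by have := sL j (ltn_ord j); rewrite /colsum szL.
Qed.
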